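(* For every $c>0$ there exists $\mu$ with $0<\mu<c$ such that for all sufficiently large $n$ there exist trees $T$ and $\mathcal{T}$ satisfying: (1) $\Delta(T)\leq cn$ and $\Delta(\mathcal{T})=cn$; (2) $T$ has bipartition class sizes $2n$ and $2n-\mu n$; (3) $\mathcal{T}$ has bipartition class sizes $2n$ and $\mu n$; (4) $R(T,\mathcal{T})\geq 4n+\mu n\geq \underline{R}(T,\mathcal{T})+\mu n$.
   Context: For graphs $G_1,G_2$, $R(G_1,G_2)$ is the smallest positive integer $N$ such that every red/blue colouring of the edges of $K_N$ contains a red copy of $G_1$ or a blue copy of $G_2$. For an $n'$-vertex tree $T$ with bipartition class sizes $t_1\geq t_2$ and a $\nu$-vertex tree $\mathcal{T}$ with bipartition class sizes $\tau_1\geq\tau_2$, where $n'\geq\nu$, define $\underline{R}(T,\mathcal{T})=\max\{n'+\tau_2,\nu+\min\{t_2,\nu\},\min\{2t_1,2\nu\},2\tau_1\}-1$. $\Delta$ denotes maximum degree.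
   Formalization: The claim is proved for 0 < c ≤ 2; for c > 2 it is false, since (2) and (3) force Δ(𝒯) ≤ 2n < cn, against (1). The degree cn of 𝒯 and the class size μn are read as integer parts. *)

(* Defs.v *)
From mathcomp Require Import all_boot all_order all_algebra.
From mathcomp Require Export reals.

Set Implicit Arguments.
Unset Strict Implicit.
Unset Printing Implicit Defensive.

Record sgraph := SGraph {
  svertex :> finType;
  sedge : rel svertex;
  sedge_sym : symmetric sedge;
  sedge_irrefl : irreflexive sedge
}.

(* [ucycle] also holds of the two-element sequences [:: x; y] with x adjacent
   to y, which are not cycles of the graph; hence the bound 2. *)
Definition acyclic (G : sgraph) : Prop :=
  forall p : seq G, ucycle (@sedge G) p -> (size p <= 2)%N.

Definition connected (G : sgraph) : Prop :=
  (0 < #|G|)%N /\ forall x y : G, connect (@sedge G) x y.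

Definition is_tree (G : sgraph) : Prop := connected G /\ acyclic G.

Definition max_degree (G : sgraph) : nat :=
  \max_(x : G) #|[set y : G | sedge x y]|.

Definition is_bipartition (G : sgraph) (A : {set G}) : bool :=
  [forall x, forall y, sedge x y ==> ((x \in A) != (y \in A))].

(* A tree has a bipartition {A, ~: A}, unique up to exchanging A and ~: A, so
   the two class sizes below do not depend on the choice.  The default [set0]
   is used only for graphs that are not bipartite. *)
Definition bipart (G : sgraph) : {set G} :=
  odflt set0 [pick A : {set G} | is_bipartition A].

Definition large_class (G : sgraph) : nat :=
  maxn #|bipart G| #|~: bipart G|.

Definition small_class (G : sgraph) : nat :=
  minn #|bipart G| #|~: bipart G|.

(* f embeds G as a (not necessarily induced) subgraph of (V, e). *)
Definition is_copy (G : sgraph) (V : finType) (e : rel V) (f : {ffun G -> V}) :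
    bool :=
  injectiveb f && [forall x, forall y, sedge x y ==> e (f x) (f y)].

Definition contains (G : sgraph) (V : finType) (e : rel V) : bool :=
  [exists f : {ffun G -> V}, is_copy e f].

(* A red/blue colouring of the edges of K_N is given by its set E of red
   edges; all the other pairs of distinct vertices are blue.  Elements of E
   that are not pairs of distinct vertices are irrelevant. *)
Definition red (N : nat) (E : {set {set 'I_N}}) : rel 'I_N :=
  fun x y => (x != y) && ([set x; y] \in E).

Definition blue (N : nat) (E : {set {set 'I_N}}) : rel 'I_N :=
  fun x y => (x != y) && ([set x; y] \notin E).

Definition arrows (N : nat) (G1 G2 : sgraph) : bool :=
  [forall E : {set {set 'I_N}},
     contains G1 (red E) || contains G2 (blue E)].

Lemma ramsey_clique (s t : nat) : exists N, forall (V : finType) (r : rel V)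
    (D : {set V}), symmetric r -> (N <= #|D|)%N ->
  (exists A : {set V}, [/\ A \subset D, #|A| = s &
     {in A &, forall x y, x != y -> r x y}]) \/
  (exists A : {set V}, [/\ A \subset D, #|A| = t &
     {in A &, forall x y, x != y -> ~~ r x y}]).
Proof.
have triv (V : finType) (D : {set V}) (P : V -> V -> Prop) :
    exists A : {set V}, [/\ A \subset D, #|A| = 0 &
      {in A &, forall x y, x != y -> P x y}].
  by exists set0; split; rewrite ?sub0set ?cards0 // => x y; rewrite inE.
elim: s t => [|s IHs] t; first by exists 0 => V r D _ _; left; exact: triv.
elim: t => [|t [N2 H2]]; first by exists 0 => V r D _ _; right; exact: triv.
have [N1 H1] := IHs t.+1.
exists (N1 + N2).+1 => V r D rsym leD.
have /card_gt0P [v vD] : (0 < #|D|)%N by apply: leq_trans leD.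
pose Dr := [set y in D :\ v | r v y]; pose Db := [set y in D :\ v | ~~ r v y].
have cD : (N1 + N2 <= #|Dr| + #|Db|)%N.
  have -> : (#|Dr| + #|Db| = #|D :\ v|)%N.
    rewrite -(cardsID [set y | r v y] (D :\ v)).
    by congr (_ + _)%N; apply: eq_card => y; rewrite !inE // andbC.
  by rewrite (cardsD1 v D) vD in leD.
have extend (p : rel V) (B A : {set V}) : symmetric p ->
    {in B, forall y, [&& y != v, y \in D & p v y]} -> A \subset B ->
    {in A &, forall x y, x != y -> p x y} ->
    [/\ v |: A \subset D, #|v |: A| = #|A|.+1 &
      {in v |: A &, forall x y, x != y -> p x y}].
  move=> psym HB /subsetP sAB pA; split.
  - apply/subsetP=> y /setU1P [-> //|/sAB/HB]; by case/and3P.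
  - rewrite cardsU1; suff -> : v \notin A by [].
    by apply/negP=> /sAB/HB; rewrite eqxx.
  - move=> x y /setU1P [->|xA] /setU1P [->|yA]; rewrite ?eqxx // => nxy.
    + by case/and3P: (HB _ (sAB _ yA)).
    + by rewrite psym; case/and3P: (HB _ (sAB _ xA)).
    + exact: pA.
have sDr : Dr \subset D by apply/subsetP=> y; rewrite !inE; case/andP=> /andP[].
have sDb : Db \subset D by apply/subsetP=> y; rewrite !inE; case/andP=> /andP[].
have [leN1|ltN1] := leqP N1 #|Dr|.
  case: (H1 V r Dr rsym leN1) => [] [A [sA cA hA]].
    have [|h1 h2 h3] := extend r Dr A rsym _ sA hA.
      by move=> y; rewrite !inE => /andP[/andP[-> ->] ->].
    by left; exists (v |: A); rewrite h2 cA.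
  by right; exists A; split=> //; apply: subset_trans sDr.
have leN2 : (N2 <= #|Db|)%N.
  by rewrite -(leq_add2l N1); apply: leq_trans cD _; rewrite leq_add2r ltnW.
case: (H2 V r Db rsym leN2) => [] [A [sA cA hA]].
  by left; exists A; split=> //; apply: subset_trans sDb.
have [||h1 h2 h3] := extend (fun x y => ~~ r x y) Db A _ _ sA hA.
- by move=> x y; rewrite rsym.
- by move=> y; rewrite !inE => /andP[/andP[-> ->] ->].
by right; exists (v |: A); rewrite h2 cA.
Qed.

Lemma clique_contains (G : sgraph) (V : finType) (e : rel V) (A : {set V}) :
  #|A| = #|G| -> {in A &, forall x y, x != y -> e x y} -> contains G e.
Proof.
move=> cA hA; pose g (x : G) := enum_val (cast_ord (esym cA) (enum_rank x)).
have ginj : injective g.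
  by move=> x y /enum_val_inj /cast_ord_inj /enum_rank_inj.
apply/existsP; exists (finfun g); apply/andP; split.
  by apply/injectiveP => x y; rewrite !ffunE => /ginj.
apply/forallP=> x; apply/forallP=> y; apply/implyP=> exy; rewrite !ffunE.
apply: hA; rewrite ?enum_valP // (inj_eq ginj).
by apply/eqP=> xy; rewrite xy sedge_irrefl in exy.
Qed.

Lemma ramsey_exists (G1 G2 : sgraph) :
  exists N : nat, (0 < N)%N && arrows N G1 G2.
Proof.
have [N HN] := ramsey_clique #|G1| #|G2|.
exists N.+1; apply/forallP=> E.
pose r : rel 'I_N.+1 := fun x y => [set x; y] \in E.
have rsym : symmetric r by move=> x y; rewrite /r setUC.
have leN : (N <= #|[set: 'I_N.+1]|)%N by rewrite cardsT card_ord.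
case: (HN _ r setT rsym leN) => [] [A [_ cA hA]]; apply/orP; [left|right];
  apply: (clique_contains cA) => x y xA yA nxy; apply/andP; split=> //;
  exact: hA.
Qed.

Definition ramsey (G1 G2 : sgraph) : nat := ex_minn (ramsey_exists G1 G2).

(* Meant for trees T and S with #|S| <= #|T|; the formula is not symmetric in
   T and S. *)
Definition ramsey_lower (T S : sgraph) : nat :=
  (maxn (#|T| + small_class S)
  (maxn (#|S| + minn (small_class T) #|S|)
  (maxn (minn (2 * large_class T) (2 * #|S|))
        (2 * large_class S)))).-1.

(* Main.v *)
Require Import Defs.
From mathcomp Require Import all_boot all_order all_algebra.
From mathcomp Require Import zify lra.
Import Order.TTheory GRing.Theory Num.Theory.

(** The colouring has 2(2n+m) vertices, in two sides of 2n+m vertices each.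
    Red consists of both sides together with some crossing edges, all of which
    meet a small set of hubs.

    T is an odd number L of equal spiders (a centre with many legs of length
    two) joined at a root.  In a red copy, all but few of the vertices of a
    spider lie on the same side as its centre: a centre has few crossing red
    edges, and the crossing edges between the middle and the end of the legs
    form a matching whose edges all meet the hubs.  Some side gets at least
    (L+1)/2 centres, hence about 2n(1+1/L) vertices, which is too many.

    In S a bounded number K of vertices dominate the class of size 2n.  Blue is
    bipartite, so a blue copy has this class on one side; but any K vertices of
    the other side have more than m common red neighbours there, which leaves
    fewer than 2n places.

    For the hubs, cut each side into q parts and let every hub be red to the
    union of at most K parts of the opposite side, each choice being realised
    by m+1 hubs; K/q small keeps the degrees low, and m << n / 2^q keeps
    the hubs few. *)

Set Implicit Arguments.
Unset Strict Implicit.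
Unset Printing Implicit Defensive.

(** * Trees on an initial segment of the integers, given by a parent function *)

Section ParentTree.
Variables (N : nat) (p : nat -> nat).

(** The comparison in each disjunct discards the values [p i >= i], so the graph is irreflexive and
    acyclic for every [p]. *)
Definition parent_edge : rel 'I_N :=
  fun x y => ((x < y) && (p y == x)) || ((y < x) && (p x == y)).

Lemma parent_edge_sym : symmetric parent_edge.
Proof. by move=> x y; rewrite /parent_edge orbC. Qed.

Lemma parent_edge_irrefl : irreflexive parent_edge.
Proof. by move=> x; rewrite /parent_edge ltnn. Qed.

Definition parent_graph : sgraph := SGraph parent_edge_sym parent_edge_irrefl.

Lemma card_parent_graph : #|parent_graph| = N.
Proof. exact: card_ord. Qed.

Lemma parent_edge_child (x y : 'I_N) : x < y -> p y = x -> parent_edge x y.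
Proof. by move=> xy pyx; rewrite /parent_edge xy pyx eqxx. Qed.

Lemma parent_edge_lt (x y : 'I_N) : parent_edge x y -> y <= x -> p x = y.
Proof.
by rewrite /parent_edge => /orP [/andP [xy _]|/andP [_ /eqP]] //; rewrite leqNgt xy.
Qed.

(** Both neighbours of the largest vertex [v] of a cycle are smaller, hence equal to [p v]; on a
    cycle with more than two vertices they are distinct. *)
Lemma parent_graph_acyclic : acyclic parent_graph.
Proof.
move=> c cyc; rewrite leqNgt; apply/negP => sz.
have [v0 v0c] : exists v0 : 'I_N, v0 \in c.
  by case: c sz {cyc} => // v0 c _; exists v0; rewrite mem_head.
case: (@arg_maxnP _ v0 (mem c) (fun x : 'I_N => nat_of_ord x) v0c) => v vc vmax.
have [i s def_s] := rot_to vc.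
have szs : 1 < size s by rewrite -(size_rot i) def_s in sz.
have le_v x : x \in v :: s -> (x : 'I_N) <= v.
  by rewrite -def_s mem_rot => /vmax.
move: cyc; rewrite -(rot_ucycle i) def_s.
case: s szs le_v {def_s} => [|y s] //=; case/lastP: s => [|s z] // _ le_v.
rewrite /ucycle /= -rcons_cons => /andP [].
rewrite !rcons_path !last_rcons => /and3P [vy _ zv].
rewrite /= rcons_uniq !mem_rcons !inE => /andP [_ /andP [/norP [/eqP yz _] _]].
apply: yz; apply/val_inj => /=.
rewrite -(@parent_edge_lt v y) ?le_v ?inE ?eqxx ?orbT //.
by rewrite -(@parent_edge_lt v z) ?le_v ?inE ?mem_rcons ?inE ?eqxx ?orbT // parent_edge_sym.
Qed.

Hypothesis N_gt0 : 0 < N.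
Hypothesis p_lt : forall i, 0 < i < N -> p i < i.

Lemma parent_graph_connected : connected parent_graph.
Proof.
split; first by rewrite card_parent_graph.
pose r : 'I_N := Ordinal N_gt0.
have H (x : 'I_N) : connect parent_edge r x.
  case: x => x; elim/ltn_ind: x => -[|x] IH xN.
    by rewrite (_ : Ordinal xN = r) ?connect0 //; apply/val_inj.
  have px : p x.+1 < x.+1 by apply: p_lt.
  have pN := ltn_trans px xN.
  apply: connect_trans (IH _ px pN) (connect1 _).
  exact: parent_edge_child.
move=> x y; apply: (@connect_trans _ _ r) => //.
by rewrite (sym_connect_sym parent_edge_sym).
Qed.

Lemma parent_graph_tree : is_tree parent_graph.
Proof. split; [exact: parent_graph_connected | exact: parent_graph_acyclic]. Qed.

Lemma parent_graph_bipartition (A : {set parent_graph}) :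
  (forall x y : 'I_N, x < y -> p y = x -> (x \in A) != (y \in A)) ->
  is_bipartition A.
Proof.
move=> HA; apply/forallP => x; apply/forallP => y; apply/implyP.
case/orP=> /andP [xy /eqP pxy]; first exact: HA.
by rewrite eq_sym; apply: HA.
Qed.

End ParentTree.

(** * Bipartition classes, and Ramsey lower bounds from a colouring *)

(** Membership in [A] and in [B] both flip along an edge, so the set where they agree is closed
    under adjacency: by connectedness it is everything or empty. *)
Lemma bipartition_unique (G : sgraph) (A B : {set G}) : connected G ->
  is_bipartition A -> is_bipartition B -> B = A \/ B = ~: A.
Proof.
move=> [/card_gt0P [r _] conn] bA bB.
have H x : ((x \in A) == (x \in B)) = ((r \in A) == (r \in B)).
  have cl : closed (@sedge G) [pred x | (x \in A) == (x \in B)].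
    move=> y z yz; rewrite !inE.
    move: (implyP (forallP (forallP bA y) z) yz).
    move: (implyP (forallP (forallP bB y) z) yz).
    by do 4!case: (_ \in _).
  by have := closed_connect cl (conn x r); rewrite !inE.
case: ((r \in A) == (r \in B)) H => H; [left|right]; apply/setP => x.
  by move/eqP: (H x).
by move: (H x); rewrite inE; do 2!case: (_ \in _).
Qed.

(** [bipart] picks an unspecified bipartition; by uniqueness any explicit one gives the class
    sizes. *)
Lemma class_sizes (G : sgraph) (A : {set G}) : connected G ->
  is_bipartition A ->
  large_class G = maxn #|A| #|~: A| /\ small_class G = minn #|A| #|~: A|.
Proof.
move=> conn bA; rewrite /large_class /small_class.
have bB : is_bipartition (bipart G).
  rewrite /bipart; case: pickP => [B|/(_ A)] //=; by rewrite bA.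
case: (bipartition_unique conn bA bB) => -> //.
by rewrite setCK maxnC minnC.
Qed.

Lemma contains_comp (G : sgraph) (V W : finType) (e : rel V) (e' : rel W)
    (i : V -> W) : injective i -> (forall x y, e x y -> e' (i x) (i y)) ->
  contains G e -> contains G e'.
Proof.
move=> inj_i ee' /existsP [f /andP [/injectiveP inj_f /forallP Hf]].
apply/existsP; exists [ffun x => i (f x)]; apply/andP; split.
  by apply/injectiveP => x y; rewrite !ffunE => /inj_i /inj_f.
apply/forallP => x; apply/forallP => y; apply/implyP => xy; rewrite !ffunE.
by apply: ee'; move/forallP/(_ y)/implyP: (Hf x); apply.
Qed.

Lemma containsP (G : sgraph) (V : finType) (e : rel V) :
  reflect (exists2 f : G -> V, injective f & forall x y, sedge x y -> e (f x) (f y))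
    (contains G e).
Proof.
apply: (iffP existsP) => [[f /andP [/injectiveP inj_f /forallP Hf]]|[f inj_f Hf]].
  by exists f => // x y; move/forallP/(_ y)/implyP: (Hf x); apply.
exists (finfun f); apply/andP; split.
  by apply/injectiveP => x y; rewrite !ffunE => /inj_f.
by apply/forallP => x; apply/forallP => y; apply/implyP; rewrite !ffunE => /Hf.
Qed.

(** A good colouring on any finite [V] restricts to every [K_N] with [N <= #|V|], so no such [N]
    arrows. *)
Lemma ramsey_gt (G1 G2 : sgraph) (V : finType) (r : rel V) : symmetric r ->
  ~~ contains G1 (fun x y => (x != y) && r x y) ->
  ~~ contains G2 (fun x y => (x != y) && ~~ r x y) ->
  #|V| < ramsey G1 G2.
Proof.
move=> rsym nG1 nG2; rewrite /ramsey; case: ex_minnP => N /andP [_ /forallP arr] _.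
rewrite ltnNge; apply/negP => leNV.
pose i (x : 'I_N) : V := enum_val (widen_ord leNV x).
have inj_i : injective i by move=> x y /enum_val_inj /(congr1 val) /= /val_inj.
pose E := [set e : {set 'I_N} |
  [forall x in e, forall y in e, (x != y) ==> r (i x) (i y)]].
have inE2 x y : x != y -> ([set x; y] \in E) = r (i x) (i y).
  move=> xy; rewrite inE; apply/forall_inP/idP => [/(_ x (set21 x y)) /forall_inP|rxy u].
    by move=> /(_ y (set22 x y)); rewrite xy.
  move=> uxy; apply/forall_inP => v vxy; apply/implyP.
  by case/set2P: uxy => ->; case/set2P: vxy => ->; rewrite ?eqxx // rsym.
case/orP: (arr E) => [|] H; [move/negP: nG1 | move/negP: nG2]; apply;
  apply: contains_comp H => [|x y]; try exact: inj_i;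
  by rewrite /red /blue (inj_eq inj_i) => /andP [xy]; rewrite inE2 ?xy.
Qed.

(** * Counting by injections, and the hubs *)

Lemma card_le_nat (T : finType) (A : {set T}) (f : T -> nat) (b : nat) :
  {in A &, injective f} -> {in A, forall x, f x < b} -> #|A| <= b.
Proof.
move=> inj_f ltb; rewrite cardE -(size_map f) -(size_iota 0 b).
apply: uniq_leq_size => [|y /mapP [x]].
  by rewrite map_inj_in_uniq ?enum_uniq // => x y; rewrite !mem_enum; apply: inj_f.
by rewrite mem_enum mem_iota => /ltb ? ->.
Qed.

Lemma card_ge_inj (S T : finType) (A : {set T}) (f : S -> T) :
  injective f -> (forall i, f i \in A) -> #|S| <= #|A|.
Proof.
move=> inj_f fA; rewrite -cardsT -(card_imset _ inj_f); apply: subset_leq_card.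
by apply/subsetP => _ /imsetP [x _ ->].
Qed.

(** The parts are the residue classes modulo [q]. The sets of parts are enumerated, and each one
    labels a block of [m.+1] consecutive indices. At most [K] vertices meet at most [K] parts, and
    the block labelled by these parts consists of common neighbours. *)
Lemma hub_system (q K m k : nat) : 0 < q -> 2 ^ q * m.+1 <= k ->
  exists (hub : rel 'I_k) (H : {set 'I_k}),
  [/\ #|H| <= 2 ^ q * m.+1,
      forall i j, hub i j -> i \in H,
      forall i, #|[set j | hub i j]| <= K * (k %/ q).+1 &
      forall C : {set 'I_k}, #|C| <= K ->
        m < #|[set i | [forall j in C, hub i j]]|].
Proof.
move=> q_gt0 le_k.
pose part (j : 'I_k) : 'I_q := Ordinal (ltn_pmod j q_gt0).
(* By the default [set0], indices from [2 ^ q * m.+1] on have an empty label and are not hubs. *)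
pose label (i : 'I_k) := nth set0 (enum {: {set 'I_q}}) (i %/ m.+1).
have sz : size (enum {: {set 'I_q}}) = 2 ^ q.
  by rewrite -cardE -cardsT -powersetT card_powerset cardsT card_ord.
exists (fun i j => (#|label i| <= K) && (part j \in label i)).
exists [set i : 'I_k | i < 2 ^ q * m.+1]; split.
- apply: (@card_le_nat _ _ (@nat_of_ord k)) => [x y _ _ /val_inj //|x].
  by rewrite inE.
- move=> i j /andP [_]; rewrite inE /label; case: (ltnP i) => // le_i.
  by rewrite nth_default ?inE // sz leq_divRL.
- move=> i; case: (leqP #|label i| K) => /= leK; last first.
    by rewrite (_ : [set _ | _] = set0) ?cards0 //; apply/setP => j; rewrite !inE.
  have ltk (j : 'I_k) : j %/ q < (k %/ q).+1.
    by rewrite ltnS leq_div2r // ltnW.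
  (* Residue and quotient determine [j], so a part has at most [(k %/ q).+1] elements. *)
  pose f (j : 'I_k) := (part j, Ordinal (ltk j)).
  have inj_f : injective f.
    move=> x y e; have exy := congr1 (fun u => val u.1) e.
    have dxy := congr1 (fun u => val u.2) e; apply/val_inj.
    by move: exy dxy => /= exy dxy; rewrite /= (divn_eq x q) (divn_eq y q) exy dxy.
  rewrite -(card_imset _ inj_f).
  apply: (@leq_trans #|setX (label i) [set: 'I_(k %/ q).+1]|).
    by apply/subset_leq_card/subsetP => y /imsetP [j]; rewrite inE => pj ->; rewrite !inE pj.
  by rewrite cardsX cardsT card_ord leq_mul2r leK orbT.
- move=> C leC; pose P := [set part j | j in C].
  have ltP : index P (enum {: {set 'I_q}}) < 2 ^ q.
    by rewrite -sz index_mem mem_enum.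
  have lti (t : 'I_m.+1) : index P (enum {: {set 'I_q}}) * m.+1 + t < k.
    apply: leq_trans le_k; apply: (@leq_trans ((index P (enum {: {set 'I_q}})).+1 * m.+1)).
      by rewrite mulSn addnC ltn_add2r.
    by rewrite leq_mul2r ltP orbT.
  rewrite -[X in X <= _]card_ord.
  apply: (@card_ge_inj _ _ _ (fun t => Ordinal (lti t))) => [x y [/addnI /val_inj //]|t].
  have lab : label (Ordinal (lti t)) = P.
    rewrite /label /= divnMDl // divn_small // addn0 nth_index ?mem_enum //.
  rewrite inE lab; apply/forall_inP => j jC.
  by rewrite imset_f // (leq_trans (leq_imset_card _ _)).
Qed.

(** * The two-sided colouring has no blue S and no red T *)

Section Colouring.
Variables (k : nat) (hub : rel 'I_k).

(** The Boolean is the side. [hub] sees only the indices, so an index in the hub set is a hub on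
    both sides. *)
Definition hub_red : rel (bool * 'I_k) :=
  fun x y => [|| x.1 == y.1, hub x.2 y.2 | hub y.2 x.2].

Lemma hub_red_sym : symmetric hub_red.
Proof. by move=> x y; rewrite /hub_red eq_sym [hub _ _ || _]orbC. Qed.

(** Blue edges cross, so the [sc j] lie opposite to [w0] and all [lv i] lie on the side of [w0].
    There the [lv i] avoid the more than [m] common red neighbours of the [sc j], leaving fewer than
    [N] places. *)
Lemma no_blue_copy (S : sgraph) (K N m : nat) (w0 : S) (sc : 'I_K -> S)
    (lv : 'I_N -> S) :
  (forall C : {set 'I_k}, #|C| <= K -> m < #|[set i | [forall j in C, hub i j]]|) ->
  (forall j, sedge w0 (sc j)) -> injective lv ->
  (forall i, exists j, sedge (sc j) (lv i)) -> k <= N + m ->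
  ~~ contains S (fun x y => (x != y) && ~~ hub_red x y).
Proof.
move=> Hcom e0 inj_lv elv le_k; apply/containsP => -[f inj_f Hf].
pose C := [set (f (sc j)).2 | j : 'I_K].
have leC : #|C| <= K by rewrite -[X in _ <= X]card_ord; apply: leq_imset_card.
have := Hcom C leC; set Z := [set i | _] => ltZ.
have [e1 e2] : (forall j, (f (sc j)).1 = ~~ (f w0).1) /\ (forall i, (f (lv i)).1 = (f w0).1).
  have e1 j : (f (sc j)).1 = ~~ (f w0).1.
    have /andP [_ /norP [+ _]] := Hf _ _ (e0 j).
    by case: (f w0).1; case: (f (sc j)).1.
  split=> // i; have [j /Hf /andP [_ /norP [+ _]]] := elv i.
  by rewrite e1; case: (f w0).1; case: (f (lv i)).1.
have : #|'I_N| <= #|~: Z|.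
  apply: (@card_ge_inj _ _ _ (fun i => (f (lv i)).2)) => [x y exy|i].
    by apply/inj_lv/inj_f/eqP; rewrite -pair_eqE /pair_eq /= exy !e2 !eqxx.
  rewrite !inE; apply/negP => /forall_inP hubC.
  have [j /Hf /andP [_ /norP [_ /norP [_]]]] := elv i.
  by rewrite hubC // (imset_f (fun j => (f (sc j)).2)).
by have := cardsC Z; rewrite !card_ord; lia.
Qed.

(** Let [P] be the legs at the centres on the majority side [s]. [B1] collects those whose middle
    crosses; a leg whose leaf crosses uses a hub as middle ([B2]) or as leaf ([B3]); the legs in [G]
    take two vertices of side [s] each, so there are at most [k / 2] of them. *)
Lemma no_red_copy (T : sgraph) (H : {set 'I_k}) (l w d : nat)
    (ctr : 'I_(2 * l).+1 -> T) (mid leaf : 'I_(2 * l).+1 * 'I_w -> T) :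
  (forall i j, hub i j -> i \in H) -> (forall i, #|[set j | hub i j]| <= d) ->
  injective mid -> injective leaf -> (forall u v, mid u != leaf v) ->
  (forall u, sedge (ctr u.1) (mid u)) -> (forall u, sedge (mid u) (leaf u)) ->
  k + 2 * ((2 * l).+1 * (d + #|H|) + 2 * #|H|) < 2 * (l.+1 * w) ->
  ~~ contains T (fun x y => (x != y) && hub_red x y).
Proof.
move=> hubH hubd inj_mid inj_leaf mid_leaf e1 e2 lt_k.
apply/containsP => -[f inj_f Hf].
have crossH x y : hub_red (f x) (f y) -> (f x).1 != (f y).1 ->
    ((f x).2 \in H) || ((f y).2 \in H).
  by rewrite /hub_red => /or3P [/eqP ->|/hubH ->|/hubH ->]; rewrite ?eqxx ?orbT.
(* Some side contains more than half of the spider centres. *)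
have [s [J Jl Js]] : exists s, exists2 J : {set 'I_(2 * l).+1},
    l < #|J| & forall j, j \in J -> (f (ctr j)).1 = s.
  pose J := [set j | (f (ctr j)).1]; have cJ := cardsC J; rewrite card_ord in cJ.
  case: (ltnP l #|J|) => Jl; [exists true, J|exists false, (~: J)] => //.
  - by move=> j; rewrite inE.
  - rewrite -(ltn_add2l #|J|) cJ ltnS (leq_trans (leq_add Jl (leqnn l))) //.
    by rewrite addnn mul2n.
  - by move=> j; rewrite !inE => /negbTE.
pose P := setX J [set: 'I_w].
pose B1 := [set u in P | (f (mid u)).1 != s].
pose B2 := [set u in P | ((f (mid u)).1 == s) && ((f (mid u)).2 \in H)].
pose B3 := [set u in P | ((f (leaf u)).1 == ~~ s) && ((f (leaf u)).2 \in H)].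
pose G := [set u in P | ((f (mid u)).1 == s) && ((f (leaf u)).1 == s)].
have f_inj2 t (x y : T) : (f x).1 == t -> (f y).1 == t -> (f x).2 = (f y).2 -> x = y.
  move=> /eqP fx /eqP fy exy; apply/inj_f/eqP.
  by rewrite -pair_eqE /pair_eq /= exy fx fy !eqxx.
have cB2 : #|B2| <= #|H|.
  rewrite -(@card_in_imset _ _ (fun u => (f (mid u)).2)) => [|x y].
    by apply/subset_leq_card/subsetP => _ /imsetP [u + ->]; rewrite inE => /and3P [].
  rewrite !(inE, in_setX) => /and3P [_ sx _] /and3P [_ sy _] /(f_inj2 _ _ _ sx sy).
  exact: inj_mid.
have cB3 : #|B3| <= #|H|.
  rewrite -(@card_in_imset _ _ (fun u => (f (leaf u)).2)) => [|x y].
    by apply/subset_leq_card/subsetP => _ /imsetP [u + ->]; rewrite inE => /and3P [].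
  rewrite !(inE, in_setX) => /and3P [_ sx _] /and3P [_ sy _] /(f_inj2 _ _ _ sx sy).
  exact: inj_leaf.
have cG : #|G| + #|G| <= k.
  pose A1 := [set (f (mid u)).2 | u in G]; pose A2 := [set (f (leaf u)).2 | u in G].
  have c1 : #|A1| = #|G|.
    apply: card_in_imset => x y.
    rewrite !(inE, in_setX) => /and3P [_ sx _] /and3P [_ sy _] /(f_inj2 _ _ _ sx sy).
    exact: inj_mid.
  have c2 : #|A2| = #|G|.
    apply: card_in_imset => x y.
    rewrite !(inE, in_setX) => /and3P [_ _ sx] /and3P [_ _ sy] /(f_inj2 _ _ _ sx sy).
    exact: inj_leaf.
  have dis : A1 :&: A2 = set0.
    apply/eqP; rewrite -subset0; apply/subsetP => i /setIP [/imsetP [u uG ->] /imsetP [v vG]].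
    move: uG vG; rewrite !(inE, in_setX) => /and3P [_ sx _] /and3P [_ _ sy] /(f_inj2 _ _ _ sx sy) e.
    by have := mid_leaf u v; rewrite e eqxx.
  rewrite -{1}c1 -c2 -cardsUI dis cards0 addn0 -[X in _ <= X]card_ord.
  exact: max_card.
(* A crossing middle is one of the [d] vertices for which its centre is a hub, or is a hub
   itself. *)
have cB1 : #|B1| <= (2 * l).+1 * (d + #|H|).
  have cj j : j \in J -> #|[set t | (j, t) \in B1]| <= d + #|H|.
    move=> jJ; set i := (f (ctr j)).2.
    apply: (@leq_trans #|[set i' | hub i i'] :|: H|); last first.
      by apply: leq_trans (leq_card_setU _ _) _; rewrite leq_add2r.
    rewrite -(@card_in_imset _ _ (fun t => (f (mid (j, t))).2)) => [|x y].
      apply/subset_leq_card/subsetP => _ /imsetP [t + ->].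
      rewrite !(inE, in_setX) => /andP [_ ns].
      have /andP [_ /or3P [/eqP e|->|/hubH ->]] := Hf _ _ (e1 (j, t)); rewrite ?orbT //.
      by rewrite -e Js // eqxx in ns.
    rewrite !(inE, in_setX) => /andP [_ sx] /andP [_ sy] /f_inj2 exy.
    have [] // : (j, x) = (j, y); apply/inj_mid/(exy (~~ s)).
      by case: (f _).1 sx; case: (s).
    by case: (f _).1 sy; case: (s).
  have -> : #|B1| = \sum_(j in J) #|[set t | (j, t) \in B1]|.
    under eq_bigr do rewrite -sum1_card.
    rewrite pair_big_dep -sum1_card; apply: eq_bigl => -[j t] /=.
    by rewrite !(inE, in_setX) /=; case: (j \in J).
  apply: (@leq_trans (\sum_(j in J) (d + #|H|))); first exact: leq_sum.
  by rewrite sum_nat_const leq_mul2r -[X in _ <= X]card_ord max_card orbT.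
have subP : P \subset B1 :|: B2 :|: B3 :|: G.
  apply/subsetP => u uP; rewrite !in_setU.
  have := crossH _ _ (andP (Hf _ _ (e2 u))).2.
  move: uP; rewrite !inE => ->.
  have [ms|//] := eqVneq (f (mid u)).1 s; rewrite ms /=.
  have [//|nls] := eqVneq (f (leaf u)).1 s; first by rewrite orbT.
  have -> : (f (leaf u)).1 = ~~ s by case: (f _).1 nls; case: (s).
  by rewrite eqxx orbF; apply; case: (s).
have leP : l.+1 * w <= #|B1| + #|B2| + #|B3| + #|G|.
  apply: (@leq_trans #|P|); first by rewrite cardsX cardsT card_ord leq_mul2r Jl orbT.
  apply: leq_trans (subset_leq_card subP) _.
  by do 3!(apply: leq_trans (leq_card_setU _ _) _; rewrite ?leq_add2r).
have arith X h g W : k + 2 * (X + 2 * h) < 2 * W -> g + g <= k ->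
  W <= X + h + h + g -> False by lia.
apply: arith lt_k cG (leq_trans leP _).
exact: leq_add (leq_add (leq_add cB1 cB2) cB3) (leqnn _).
Qed.

End Colouring.

(** * Degrees and classes in parent trees *)

(** A vertex has at most one parent, the vertex 0 has none, and all other neighbours are
    children. *)
Lemma degree_le (N : nat) (p : nat -> nat) (x : parent_graph N p) :
  #|[set y | sedge x y]| <=
  (0 < (x : 'I_N)) + #|[set y : 'I_N | ((x : 'I_N) < y) && (p y == (x : 'I_N))]|.
Proof.
pose P := [set y : 'I_N | (y < (x : 'I_N)) && (p (x : 'I_N) == y)].
have cP : #|P| <= (0 < (x : 'I_N)).
  apply: (@card_le_nat _ _ (fun y : 'I_N => 0)) => [y z|y]; rewrite !inE; last by lia.
  by move=> /andP [_ /eqP yE] /andP [_ /eqP zE] _; apply/val_inj; rewrite /= -yE -zE.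
apply: leq_trans (leq_add cP (leqnn _)); apply: leq_trans (leq_card_setU _ _).
apply/subset_leq_card/subsetP => y; rewrite !inE /= /parent_edge.
by rewrite orbC.
Qed.

(** Enumerates the class of the root in both trees below: 0 together with an interval starting at
    [a.+1]. *)
Definition skip (a i : nat) : nat := if i == 0 then 0 else a + i.

Lemma skip_inj a : injective (skip a).
Proof. by move=> x y; rewrite /skip; case: (x =P 0); case: (y =P 0) => ? ?; lia. Qed.

Lemma skip_lt a b N i : a + b <= N -> i < b -> skip a i < N.
Proof. by rewrite /skip; case: (i =P 0); lia. Qed.

Lemma card_skip (N a b : nat) : 0 < b -> a + b <= N ->
  #|[set x : 'I_N | (x == 0 :> nat) || (a < x < a + b)]| = b.
Proof.
move=> b_gt0 le_N; apply/eqP; rewrite eqn_leq; apply/andP; split.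
  apply: (@card_le_nat _ _ (fun x : 'I_N => x - a)) => [x y|x]; rewrite !inE; last by lia.
  by move=> Hx Hy exy; apply/val_inj => /=; lia.
rewrite -[X in X <= _]card_ord.
have lt (i : 'I_b) : skip a i < N by apply: skip_lt le_N (ltn_ord i).
apply: (@card_ge_inj _ _ _ (fun i => Ordinal (lt i))) => [x y [/skip_inj /val_inj //]|i].
by rewrite inE /= /skip; have := ltn_ord i; case: (nat_of_ord i =P 0) => //=; lia.
Qed.

(** * The tree S *)

Section BroomTree.
Variables D K m n : nat.
(** [ltK] says that the [2n - 1] leaves fit into [K] blocks of [D - 1]; [le_D2n] makes the first
    block full, so that the degree [D] is attained. *)
Hypotheses (D_gt1 : 1 < D) (K_gt0 : 0 < K) (le_Km : K <= m) (le_mD : m <= D)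
  (le_D2n : D <= 2 * n) (ltK : 2 * n < K * D.-1 + 2).

(* Vertices: the root 0, its m children 1, ..., m, and then 2n - 1 leaves, shared
   out among the first children in blocks of D - 1. *)
Definition broom_parent (i : nat) : nat :=
  if i <= m then 0 else ((i - m.+1) %/ D.-1).+1.

Definition broom : sgraph := parent_graph (2 * n + m) broom_parent.

Lemma broom_parent_lt i : 0 < i -> broom_parent i < i.
Proof.
move=> i_gt0; rewrite /broom_parent; case: (leqP i m) => // lt_mi.
by have := leq_div (i - m.+1) D.-1; move: (_ %/ _) => t; lia.
Qed.

Lemma broom_branch i : m < i < 2 * n + m -> (i - m.+1) %/ D.-1 < K.
Proof. by move=> Hi; rewrite ltn_divLR; lia. Qed.

Lemma broom_tree : is_tree broom.
Proof.
apply: parent_graph_tree; first by lia.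
by move=> i /andP [+ _]; apply: broom_parent_lt.
Qed.

Lemma broom_classes : large_class broom = 2 * n /\ small_class broom = m.
Proof.
pose A : {set broom} := [set x : 'I_(2 * n + m) | (x == 0 :> nat) || (m < x < m + 2 * n)].
have cA : #|A| = 2 * n by apply: card_skip; lia.
have cAC : #|~: A| = m.
  by have := cardsC A; rewrite card_parent_graph cA => /addnI.
have bA : is_bipartition A.
  apply: parent_graph_bipartition => x y xy; rewrite !inE /broom_parent.
  have := ltn_ord y; case: (leqP y m) => [|lt_my] lt_y; first by lia.
  by have := @broom_branch y; lia.
have [-> ->] := class_sizes broom_tree.1 bA.
by rewrite cA cAC; split; lia.
Qed.

Lemma broom_max_degree : max_degree broom = D.
Proof.
apply/eqP; rewrite eqn_leq; apply/andP; split.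
  apply/bigmax_leqP => x _; apply: leq_trans (degree_le x) _.
  case: (posnP (x : 'I_(2 * n + m))) => [x0|x_gt0].
    apply: leq_trans le_mD.
    apply: (@card_le_nat _ _ (fun y : 'I_(2 * n + m) => y.-1)) => [y z|y];
      rewrite !inE x0 /broom_parent; last by case: ifP => //; lia.
    by move=> Hy Hz e; apply/val_inj => /=; lia.
  (* One parent, and the children form one block, separated by residues modulo [D.-1]. *)
  rewrite -[X in _ <= X](prednK (ltnW D_gt1)) ltnS.
  apply: (@card_le_nat _ _ (fun y : 'I_(2 * n + m) => (y - m.+1) %% D.-1)) => [y z|y _]; last first.
    by rewrite ltn_pmod; lia.
  rewrite !inE /broom_parent; case: (leqP y m) => [|lt_y]; first by lia.
  case: (leqP z m) => [|lt_z]; first by lia.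
  move=> /andP [_ /eqP ey] /andP [_ /eqP ez] e; apply/val_inj => /=.
  have := divn_eq (y - m.+1) D.-1; rewrite e.
  have -> : (y - m.+1) %/ D.-1 = (z - m.+1) %/ D.-1 by lia.
  by rewrite -divn_eq; lia.
(* Vertex 1 attains [D]: its neighbours are the root and the full first block, which is the image of
   [skip m] on ['I_D]. *)
have lt1 : 1 < 2 * n + m by lia.
apply: leq_trans (leq_bigmax (F := fun x : broom => #|[set y | sedge x y]|) (Ordinal lt1 : broom)).
have lt (i : 'I_D) : skip m i < 2 * n + m by apply: skip_lt (ltn_ord i); lia.
rewrite -[X in X <= _]card_ord.
apply: (@card_ge_inj _ _ _ (fun i => Ordinal (lt i) : broom)) => [x y [/skip_inj /val_inj //]|i].
rewrite inE /= /parent_edge /broom_parent /skip /=; have := ltn_ord i.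
case: (nat_of_ord i =P 0) => [_|i0] ltD /=; first by rewrite (_ : 1 <= m) ?eqxx ?orbT //; lia.
apply/orP; left; case: (leqP _ m) => [|_]; first by lia.
by rewrite divn_small ?eqxx ?andbT; lia.
Qed.

Lemma broom_no_blue k (hub : rel 'I_k) :
  (forall C : {set 'I_k}, #|C| <= K -> m < #|[set i | [forall j in C, hub i j]]|) ->
  k <= 2 * n + m ->
  ~~ contains broom (fun x y => (x != y) && ~~ hub_red hub x y).
Proof.
move=> Hcom le_k.
have lt0 : 0 < 2 * n + m by lia.
have ltc (j : 'I_K) : j.+1 < 2 * n + m by have := ltn_ord j; lia.
have ltl (i : 'I_(2 * n)) : skip m i < 2 * n + m by apply: skip_lt (ltn_ord i); lia.
have e0 (j : 'I_K) : @sedge broom (Ordinal lt0) (Ordinal (ltc j)).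
  rewrite /= /parent_edge /broom_parent /=.
  by rewrite (_ : j < m) //; have := ltn_ord j; lia.
apply: (no_blue_copy (K := K) (w0 := Ordinal lt0 : broom)
  (sc := fun j => Ordinal (ltc j)) (lv := fun i => Ordinal (ltl i))) Hcom _ _ _ le_k => //.
  by move=> x y [/skip_inj /val_inj].
move=> i; case: (posnP i) => i0.
  exists (Ordinal K_gt0); rewrite sedge_sym.
  rewrite (_ : Ordinal (ltl i) = Ordinal lt0) //; apply/val_inj.
  by rewrite /= /skip i0.
have skE : skip m i = m + i by rewrite /skip; case: (nat_of_ord i =P 0) i0 => // ->.
have br : (skip m i - m.+1) %/ D.-1 < K by apply: broom_branch; have := ltn_ord i; lia.
exists (Ordinal br); apply: parent_edge_child => /=.
  by have := leq_div (skip m i - m.+1) D.-1; move: (_ %/ _) br => t; lia.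
by rewrite /broom_parent ifN //; lia.
Qed.

End BroomTree.

(** * The tree T *)

Section SpiderTree.
Variables l m n : nat.
Notation L := (2 * l).+1.
Hypotheses (n_gt0 : 0 < n) (le_n : m + L <= 2 * n).

(* Vertices: the root 0, the L centres, the 2n - 1 middles (assigned to the
   centres cyclically), and one leaf for each of the first 2n - m - L middles. *)
Definition spider_parent (i : nat) : nat :=
  if i <= L then 0 else
  if i < L + 2 * n then ((i - L.+1) %% L).+1 else i - (2 * n).-1.

Definition spider : sgraph := parent_graph (4 * n - m) spider_parent.

Lemma spider_parent_lt i : 0 < i -> spider_parent i < i.
Proof.
move=> i_gt0; rewrite /spider_parent; case: (leqP i L) => // lt_Li.
case: (ltnP i (L + 2 * n)) => _; last by lia.
by have := ltn_pmod (i - L.+1) (ltn0Sn (2 * l)); move: (_ %% _) => t; lia.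
Qed.

Lemma spider_tree : is_tree spider.
Proof.
apply: parent_graph_tree; first by lia.
by move=> i /andP [+ _]; apply: spider_parent_lt.
Qed.

Lemma spider_classes :
  large_class spider = 2 * n /\ small_class spider = 2 * n - m.
Proof.
pose A : {set spider} := [set x : 'I_(4 * n - m) | (x == 0 :> nat) || (L < x < L + 2 * n)].
have cA : #|A| = 2 * n by apply: card_skip; lia.
have cAC : #|~: A| = 2 * n - m.
  by have := cardsC A; rewrite card_parent_graph cA; lia.
have bA : is_bipartition A.
  apply: parent_graph_bipartition => x y xy; rewrite !inE /spider_parent.
  have := ltn_ord y; case: (leqP y L) => [|lt_Ly] lt_y; first by lia.
  have := ltn_pmod (y - L.+1) (ltn0Sn (2 * l)); move: (_ %% _) => t.
  by case: (ltnP y (L + 2 * n)) => lt_y2; lia.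
have [-> ->] := class_sizes spider_tree.1 bA.
by rewrite cA cAC; split; lia.
Qed.

Lemma spider_max_degree D : 1 < D -> L <= D -> (2 * n - 2) %/ L + 2 <= D ->
  max_degree spider <= D.
Proof.
move=> D_gt1 le_LD le_D.
apply/bigmax_leqP => x _; apply: leq_trans (degree_le x) _.
case: (posnP (x : 'I_(4 * n - m))) => [x0|x_gt0].
  apply: leq_trans le_LD.
  apply: (@card_le_nat _ _ (fun y : 'I_(4 * n - m) => y.-1)) => [y z|y];
    rewrite !inE x0 /spider_parent; last by case: (leqP y L); case: (ltnP y (L + 2 * n)); lia.
  by move=> Hy Hz e; apply/val_inj => /=; lia.
(* Middles and leaves have at most one child, hence degree at most 2. *)
case: (leqP (x : 'I_(4 * n - m)) L) => [le_xL|lt_Lx]; last first.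
  apply: leq_trans D_gt1; rewrite ltnS.
  apply: (@card_le_nat _ _ (fun y : 'I_(4 * n - m) => 0)) => [y z|y] //.
  rewrite !inE /spider_parent => /andP [xy /eqP py] /andP [xz /eqP pz] _.
  apply/val_inj => /=; move: py pz.
  have := ltn_pmod (y - L.+1) (ltn0Sn (2 * l)); have := ltn_pmod (z - L.+1) (ltn0Sn (2 * l)).
  move: (_ %% _) (_ %% _) => ty tz ltty lttz.
  rewrite ifN; last by lia.
  rewrite [in X in _ -> X]ifN; last by lia.
  by do 2!case: ltnP => ?; lia.
(* The middles of one centre share a residue modulo [L], so their quotients, at most
   [(2 * n - 2) %/ L], separate them. *)
apply: leq_trans le_D; rewrite addn2 ltnS.
apply: (@card_le_nat _ _ (fun y : 'I_(4 * n - m) => (y - L.+1) %/ L)) => [y z|y];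
  rewrite !inE /spider_parent.
  case: (leqP y L) => [|lt_y]; first by lia.
  case: (leqP z L) => [|lt_z]; first by lia.
  case: (ltnP y (L + 2 * n)) => [lt_y2|]; last by lia.
  case: (ltnP z (L + 2 * n)) => [lt_z2|]; last by lia.
  move=> /andP [_ /eqP [ey]] /andP [_ /eqP [ez]] e; apply/val_inj => /=.
  have := divn_eq (y - L.+1) L; rewrite e.
  have -> : (y - L.+1) %% L = (z - L.+1) %% L by lia.
  by rewrite -divn_eq; lia.
case: (leqP y L) => [|lt_y]; first by lia.
case: (ltnP y (L + 2 * n)) => [lt_y2 _|]; last by lia.
by rewrite ltnS leq_div2r //; lia.
Qed.

(** [w] legs are used at each centre. The bound on [w * L] ensures that the first [w * L] middles
    all carry a leaf. *)
Lemma spider_no_red k d w (hub : rel 'I_k) (H : {set 'I_k}) :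
  (forall i j, hub i j -> i \in H) -> (forall i, #|[set j | hub i j]| <= d) ->
  w * L + (m + L) <= 2 * n ->
  k + 2 * (L * (d + #|H|) + 2 * #|H|) < 2 * (l.+1 * w) ->
  ~~ contains spider (fun x y => (x != y) && hub_red hub x y).
Proof.
move=> hubH hubd le_w lt_k.
have ltu (u : 'I_L * 'I_w) : u.2 * L + u.1 < w * L.
  apply: (@leq_trans (u.2.+1 * L)); last by rewrite leq_mul2r ltn_ord orbT.
  by rewrite (mulSn u.2) addnC ltn_add2r.
have ltc (j : 'I_L) : j.+1 < 4 * n - m by have := ltn_ord j; lia.
have ltm (u : 'I_L * 'I_w) : L.+1 + (u.2 * L + u.1) < 4 * n - m by have := ltu u; lia.
have ltl (u : 'I_L * 'I_w) : L + 2 * n + (u.2 * L + u.1) < 4 * n - m by have := ltu u; lia.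
have inj_u (u v : 'I_L * 'I_w) : u.2 * L + u.1 = v.2 * L + v.1 -> u = v.
  move=> e; have := congr1 (divn^~ L) e; have := congr1 (modn^~ L) e.
  rewrite !modnMDl !divnMDl // !modn_small ?divn_small // !addn0.
  by case: u v {e} => [u1 u2] [v1 v2] /= /val_inj -> /val_inj ->.
apply: (no_red_copy (ctr := fun j => Ordinal (ltc j) : spider)
  (mid := fun u => Ordinal (ltm u)) (leaf := fun u => Ordinal (ltl u))) hubH hubd _ _ _ _ _ lt_k.
- by move=> u v [/addnI /inj_u].
- by move=> u v [/addnI /inj_u].
- by move=> u v; apply/eqP => -[]; have := ltu u; lia.
- move=> u; apply: parent_edge_child => /=; first by have := ltn_ord u.1; lia.
  rewrite /spider_parent ifN; last by lia.
  rewrite ifT; last by have := ltu u; lia.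
  by rewrite addKn modnMDl modn_small.
- move=> u; apply: parent_edge_child => /=; first by lia.
  rewrite /spider_parent ifN; last by lia.
  by rewrite ifN; lia.
Qed.

End SpiderTree.

(** * Choice of the parameters *)

(** The main terms leave a surplus of about [2n / (4a + 1)] on the right. The factor 1200 keeps the
    loss from hub degrees well below it, 320 the loss from the number of hubs, and 2000 the rounding
    errors. *)
Lemma no_red_arith (a Q n m h k : nat) : 0 < a -> 0 < Q ->
  2000 * a ^ 3 * Q <= n -> 320 * a ^ 2 * Q * m <= n -> k = 2 * n + m ->
  h <= Q * m.+1 ->
  k + 2 * ((2 * (2 * a)).+1 * (2 * a * (k %/ (1200 * a ^ 3)).+1 + h) + 2 * h) <
  2 * ((2 * a).+1 * ((2 * n - m - (2 * (2 * a)).+1) %/ (2 * (2 * a)).+1)).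
Proof.
move=> a_gt0 Q_gt0 le_n le_mn kE le_h.
have a2E : a ^ 2 = a * a by rewrite expnS expn1.
have a3E : a ^ 3 = a * (a * a) by rewrite !expnS expn0 muln1.
have le_e : 1200 * a ^ 3 * (k %/ (1200 * a ^ 3)) <= k by rewrite mulnC leq_trunc_div.
have := ltn_ceil (2 * n - m - (2 * (2 * a)).+1) (ltn0Sn (2 * (2 * a))).
move: (k %/ _) (_ %/ _.+1) le_e => e w; rewrite a3E kE => le_e lt_w.
rewrite a2E in le_mn; rewrite a3E in le_n; move: {a2E a3E kE} k => _.
have a2 : a <= a * a by rewrite leq_pmull.
have a3 : a * a <= a * (a * a) by rewrite leq_pmull.
have aQ : a * (a * a) <= a * (a * a) * Q by rewrite leq_pmulr.
have Qa : a * a * Q <= a * (a * a) * Q by rewrite leq_mul2r a3 orbT.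
have aaQ : a <= a * a * Q by rewrite (leq_trans a2) ?leq_pmulr.
have am : a * m <= a * a * Q * m by rewrite leq_mul2r aaQ orbT.
have m_le : m <= a * m by rewrite leq_pmull.
have ah : a * a * h <= a * a * (Q * m.+1) by rewrite leq_mul2l le_h orbT.
have ah1 : a * h <= a * a * h by rewrite leq_mul2r a2 orbT.
have ae : a * a * e <= a * (a * a) * e by rewrite leq_mul2r a3 orbT.
have Lw : (2 * (2 * a)).+1 * w <= 5 * a * w by rewrite leq_mul2r; apply/orP; right; lia.
rewrite ltnNge; apply/negP => le_w.
(* Since [(4a + 1) w] is nearly [2n], the negated claim leaves one [w] bounded by error terms.
   Multiplied by [a], this contradicts [5 a w] being nearly [2n] or more. *)
have w_le : w <= 2 * m + 2 * (4 * a + 1) + (8 * a + 2) * (2 * a * e.+1) + (8 * a + 6) * h.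
  by move: le_w lt_w; clear; lia.
have : a * w <= a * (2 * m + 2 * (4 * a + 1) + (8 * a + 2) * (2 * a * e.+1) + (8 * a + 6) * h).
  by rewrite leq_mul2l w_le orbT.
move: lt_w Lw le_n le_mn le_e; clear w_le le_w le_h; lia.
Qed.

(** Here [l = K = 2a], [q = 1200 a^3], and each side has [2n + m] vertices. As [D + 1 > 2n / a],
    [2a] branches hold all leaves of the broom, and [4a + 1] centres keep the spider degrees below
    [D]. *)
Lemma spider_broom_pair (a Q n m D : nat) : 0 < a -> Q = 2 ^ (1200 * a ^ 3) ->
  2000 * a ^ 3 * Q <= n ->
  320 * a ^ 2 * Q * m <= n < 320 * a ^ 2 * Q * m.+1 ->
  D <= 2 * n < a * D.+1 ->
  exists T S : sgraph,
  [/\ is_tree T /\ is_tree S,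
      [/\ #|T| = 4 * n - m, #|S| = 2 * n + m & m <= n],
      max_degree T <= D /\ max_degree S = D,
      [/\ large_class T = 2 * n, small_class T = 2 * n - m,
          large_class S = 2 * n & small_class S = m] &
      4 * n + 2 * m < ramsey T S].
Proof.
move=> a_gt0 QE le_n /andP [le_mM le_Mm] /andP [le_D2n lt_D].
have Q_gt0 : 0 < Q by rewrite QE expn_gt0.
have a2E : a ^ 2 = a * a by rewrite expnS expn1.
have a3E : a ^ 3 = a * (a * a) by rewrite !expnS expn0 muln1.
have a2_gt0 : 0 < a * a by rewrite muln_gt0 a_gt0.
have a_2 : a <= a * a by rewrite leq_pmull.
have a_3 : a * a <= a * (a * a) by rewrite leq_pmull.
have le_Qn : 2000 * (a * (a * a)) <= n.
  by apply: leq_trans le_n; rewrite a3E leq_pmulr.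
have le_Qn' : Q <= n.
  by apply: leq_trans le_n; rewrite leq_pmull // a3E !muln_gt0 a_gt0.
have le_Qm : 320 * (a * a * (Q * m)) <= n.
  by apply: leq_trans le_mM; rewrite a2E !mulnA.
have le_am_n : 320 * (a * a * m) <= n.
  by apply: leq_trans le_Qm; rewrite !leq_mul2l leq_pmull ?orbT.
have le_m_aa : m <= a * a * m by rewrite leq_pmull.
have le_Qm_aa : Q * m <= a * a * (Q * m) by rewrite leq_pmull.
have lt_aD : 2000 * (a * a) <= D.
  rewrite -ltnS -(ltn_pmul2l a_gt0); apply: leq_ltn_trans lt_D.
  by clear -le_Qn; lia.
have le_am : 2 * a <= m.
  have M_gt0 : 0 < 320 * a ^ 2 * Q by rewrite a2E !muln_gt0 a_gt0.
  rewrite -ltnS -(ltn_pmul2l M_gt0); apply: leq_ltn_trans le_Mm; apply: leq_trans le_n.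
  by rewrite a2E a3E; clear; lia.
have le_mD : m <= D.
  rewrite -ltnS -(ltn_pmul2l a_gt0); apply: leq_ltn_trans lt_D.
  have : a * m <= a * a * m by rewrite leq_mul2r a_2 orbT.
  by clear -le_am_n; lia.
have le_n' : m + (2 * (2 * a)).+1 <= 2 * n by clear -le_am_n le_m_aa a_2 a_3 le_Qn a_gt0; lia.
have n_gt0 : 0 < n by clear -le_n'; lia.
have ltK : 2 * n < 2 * a * D.-1 + 2.
  have : a * D.+1 <= 2 * a * D.-1.
    rewrite [2 * a]mulnC -mulnA leq_mul2l; apply/orP; right.
    by clear -lt_aD a2_gt0; lia.
  by clear -lt_D; lia.
have [D_gt1 K_gt0 le_LD] : [/\ 1 < D, 0 < 2 * a & (2 * (2 * a)).+1 <= D].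
  by clear -lt_aD a_gt0 a_2; split; lia.
have le_wD : (2 * n - 2) %/ (2 * (2 * a)).+1 + 2 <= D.
  have : (2 * n - 2) %/ (2 * (2 * a)).+1 < D.-1.
    by rewrite ltn_divLR //; clear -ltK D_gt1; nia.
  by move: (_ %/ _) => t; clear; lia.
have le_Qk : 2 ^ (1200 * a ^ 3) * m.+1 <= 2 * n + m.
  by rewrite -QE mulnS; clear -le_Qn' le_Qm le_Qm_aa; lia.
have q_gt0 : 0 < 1200 * a ^ 3 by rewrite a3E !muln_gt0 a_gt0.
have [hub [H [cH hubH hubd hubC]]] := hub_system (2 * a) q_gt0 le_Qk.
exists (spider (2 * a) m n), (broom D m n); split.
- split; first exact: spider_tree n_gt0 le_n'.
  exact: (broom_tree D_gt1 K_gt0 le_am le_mD le_D2n ltK).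
- rewrite !card_parent_graph; split=> //.
  by clear -le_am_n le_m_aa; lia.
- split; first exact: spider_max_degree.
  exact: (broom_max_degree D_gt1 K_gt0 le_am le_mD le_D2n ltK).
- have [-> ->] := spider_classes n_gt0 le_n'.
  by have [-> ->] := broom_classes D_gt1 K_gt0 le_am le_mD le_D2n ltK.
have := ramsey_gt (hub_red_sym hub).
rewrite card_prod card_bool card_ord (_ : 2 * (2 * n + m) = 4 * n + 2 * m);
  last by clear; lia.
apply; last exact: (broom_no_blue D_gt1 K_gt0 le_am le_mD le_D2n ltK hubC).
apply: (spider_no_red (w := (2 * n - m - (2 * (2 * a)).+1) %/ (2 * (2 * a)).+1)
  n_gt0 le_n' hubH hubd).
  have := leq_trunc_div (2 * n - m - (2 * (2 * a)).+1) (2 * (2 * a)).+1.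
  by move: (_ * _.+1) => t; clear -le_n'; lia.
by apply: (no_red_arith a_gt0 Q_gt0) => //; rewrite QE.
Qed.

Local Open Scope ring_scope.

Unset Implicit Arguments.

Theorem theorem6p4 (R : realType) (c : R) (c_gt0 : 0 < c) (c_le2 : c <= 2) :
  exists mu : R, 0 < mu /\ mu < c /\
  exists n0 : nat, forall n : nat, (n0 <= n)%N ->
  exists T S : sgraph, is_tree T /\ is_tree S /\ (#|S| <= #|T|)%N /\
    ((max_degree T)%:R <= c * n%:R /\
     max_degree S = Num.truncn (c * n%:R)) /\
    (large_class T = (2 * n)%N /\
     small_class T = (2 * n - Num.truncn (mu * n%:R))%N) /\
    (large_class S = (2 * n)%N /\
     small_class S = Num.truncn (mu * n%:R)) /\
    ((ramsey T S)%:R >= 4 * n%:R + mu * n%:R /\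
     4 * n%:R + mu * n%:R >= (ramsey_lower T S)%:R + mu * n%:R).
Proof.
(* [c * a > 2] yields [2n < a (D + 1)] for the integer part [D] of [c n]. *)
pose a := (Num.truncn (2 / c)).+1.
have a_gt0 : (0 < a)%N by [].
have ca : 2 < c * a%:R by rewrite mulrC -ltr_pdivrMr // truncnS_gt.
clearbody a.
(* [Q] and [M] are kept opaque, since unification would evaluate [2 ^ _]. *)
have [Q QE] : exists Q, Q = (2 ^ (1200 * a ^ 3))%N by eexists.
have Q_gt0 : (0 < Q)%N by rewrite QE expn_gt0.
have [M ME] : exists M, M = (320 * a ^ 2 * Q)%N by eexists.
have aM : (a <= M)%N.
  rewrite ME -mulnA mulnCA expnS expn1 -mulnA leq_pmulr //.
  by rewrite !muln_gt0 a_gt0.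
have M_gt0 : 0 < M%:R :> R by rewrite ltr0n (leq_trans a_gt0).
(* With [mu = 1 / M], the integer part [m] of [mu n] satisfies [M m <= n < M (m + 1)]. *)
exists M%:R^-1; split; first by rewrite invr_gt0.
split.
  rewrite -div1r ltr_pdivrMr //; apply: (@lt_le_trans _ _ (c * a%:R)); first by lra.
  by rewrite ler_wpM2l ?ler_nat // ltW.
exists (2000 * a ^ 3 * Q)%N => n le_n.
set m := Num.truncn (M%:R^-1 * n%:R : R); set D := Num.truncn (c * n%:R).
have lt_m : M%:R^-1 * n%:R < m.+1%:R :> R by rewrite truncnS_gt.
have le_Mm : (M * m <= n < M * m.+1)%N.
  have le_m : m%:R <= M%:R^-1 * n%:R :> R by rewrite truncn_le mulr_ge0 // invr_ge0.
  rewrite -(ler_nat R) -(ltr_nat R) !natrM ![M%:R * _]mulrC.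
  by rewrite -ler_pdivlMr // -ltr_pdivrMr // ![_ / M%:R]mulrC le_m lt_m.
have le_D : D%:R <= c * n%:R by rewrite truncn_le mulr_ge0 // ltW.
have lt_D : (D <= 2 * n < a * D.+1)%N.
  rewrite -(ler_nat R) -(ltr_nat R) !natrM; apply/andP; split.
    by apply: le_trans le_D _; rewrite ler_wpM2r.
  apply: (@le_lt_trans _ _ (a%:R * (c * n%:R))); last first.
    by rewrite ltr_pM2l ?ltr0n // truncnS_gt.
  by rewrite mulrA [a%:R * _]mulrC ler_wpM2r // ltW.
rewrite ME in le_Mm; clearbody m D.
have [T [S [[trT trS] [cT cS le_mn] [dT dS] [lT sT lS sS] ram]]] :=
  spider_broom_pair a_gt0 QE le_n le_Mm lt_D.
exists T, S; split=> //; split=> //; split; first by rewrite cT cS; clear -le_mn; lia.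
split; first by split=> //; apply: le_trans le_D; rewrite ler_nat.
split=> //; split=> //; split.
  (* The strict bound [4n + 2m] absorbs the rounding: [mu n < m + 1 <= 2m + 1]. *)
  apply: (@le_trans _ _ (4 * n + 2 * m).+1%:R); last by rewrite ler_nat.
  rewrite -natrM; apply: le_trans (lerD (lexx _) (ltW lt_m)) _.
  by rewrite -natrD ler_nat; clear; lia.
(* All four terms of the maximum equal [4n]. *)
rewrite lerD2r -natrM ler_nat /ramsey_lower cT cS lT sT lS sS.
by clear -le_mn; lia.
Qed.
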